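(* Let $\mathbb{F}_q$ be a finite field and let $a,b\in M_n(\mathbb{F}_q)$ be singular $n\times n$ matrices such that $r=\mathrm{rk}(b)\ge s=\mathrm{rk}(a)$. Then $$|K_n(a,b)|\le 2q^{\,n^2-rn+r^2+\binom{\min(r,n-r)}{2}}.$$
   Context: $\mathbb{F}_q$ is a finite field of characteristic $p$. The additive character $\varphi:\mathbb{F}_q\to\mathbb{C}^*$ is $\varphi(x)=\exp(2\pi i\,\mathrm{Tr}_{\mathbb{F}_q/\mathbb{F}_p}(x)/p)$, and $\psi=\varphi\circ\mathrm{tr}$ on $M_n(\mathbb{F}_q)$, where $\mathrm{tr}$ is the matrix trace. For $a,b\in M_n(\mathbb{F}_q)$, $K_n(a,b)=\sum_{x\in \mathrm{GL}_n(\mathbb{F}_q)}\psi(ax+bx^{-1})$. Here $\binom{m}{2}=m(m-1)/2$. *)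

(* Defs.v *)
From HB Require Import structures.
From mathcomp Require Import all_boot all_order all_algebra all_fingroup all_field.
From mathcomp Require Import complex.
From mathcomp Require Import reals trigo.

Set Implicit Arguments.
Unset Strict Implicit.
Unset Printing Implicit Defensive.

Import GRing.Theory.

Local Open Scope ring_scope.
Local Open Scope complex_scope.

(* e^{it}, for real t. *)
Definition expi (R : realType) (t : R) : R[i] := cos t +i* sin t.

Section AbsoluteTrace.

Variables (F : finFieldType) (p : nat) (pcharF : p \in [pchar F]).

(* [pPrimeCharType pcharF] is F seen as a splitting field over 'F_p; its
   [galTrace] is valued in F. *)
Let Fp_ext := pPrimeCharType pcharF.

(* Tr_{F/F_p}(x), as an element of 'F_p: the default 0 is never used, see
   [Fp_traceE]. *)
Definition Fp_trace (x : F) : 'F_p :=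
  odflt 0 [pick k : 'F_p | k%:A == galTrace 1%AS {:Fp_ext} x].

Lemma Fp_traceE (x : F) :
  (Fp_trace x)%:A = galTrace 1%AS {:Fp_ext} x :> Fp_ext.
Proof.
have galF : galois 1%AS {:Fp_ext} := finField_galois (sub1v _).
have /vlineP[k Dk] := mem_galTrace galF (memvf (x : Fp_ext)).
rewrite /Fp_trace; case: pickP => [j /eqP // | /(_ k)].
by rewrite Dk eqxx.
Qed.

End AbsoluteTrace.

Section KloostermanSum.

Variables (R : realType) (F : finFieldType) (p : nat).
Variable pcharF : p \in [pchar F].

(* The coercion of an element of 'F_p to nat is its representative in
   {0, ..., p - 1}. *)
Definition add_char (x : F) : R[i] :=
  expi (2 * pi * (Fp_trace pcharF x : nat)%:R / p%:R).

Definition mx_char (n : nat) (x : 'M[F]_n) : R[i] := add_char (\tr x).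

Definition kloosterman (n : nat) (a b : 'M[F]_n) : R[i] :=
  \sum_(x in unitmx) mx_char (a *m x + b *m invmx x).

End KloostermanSum.

Arguments add_char R {F p} pcharF x.
Arguments mx_char R {F p} pcharF {n} x.
Arguments kloosterman R {F p} pcharF {n} a b.

(* Main.v *)
Require Import Defs.
From mathcomp Require Import all_boot all_order all_algebra all_fingroup all_field.
From mathcomp Require Import complex mxabelem zify ring lra.
From mathcomp Require Import reals trigo.

(** Write q for the order of F, s and r for the ranks of a and b, and m = n - s.
    Inverting the summation variable and multiplying it on both sides by
    invertible matrices turns the sum into that of phi (tr (b x + P x^-1)), where
    P is the diagonal projection of rank s; the rank of b does not change
    ([kloosterman_sum_pid]).  So the matrix of smaller rank is the normalized one.

    The matrices u with blocks 1, w, 0, g, where g is in GL_m, satisfy u P = P, so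
    averaging over x -> u x leaves the term in P alone and only affects tr (b u x).
    Let X be the m last rows of x.  The average over w vanishes unless the s first
    columns of X b do, and the average over g is the Gauss sum G(c) of
    phi (tr (c g)) over GL_m, for the square block c of the m last columns of X b.
    By the triangle inequality, |GL_m| |K| is at most the sum of |G(c)| over the
    admissible x in GL_n ([norm_kloosterman_sum_pid]).

    The Gauss sum depends only on the rank t of c, so c may be taken diagonal.  If
    t < m, summing over all the matrices got from c by putting an arbitrary row v
    in place of a zero row gives 0; since q^t of these have rank t and the others rank t + 1, the absolute
    values satisfy (q^m - q^t) |G_(t+1)| = q^t |G_t| ([norm_gauss_sum_succ]).  The
    same count of rows, applied to matrices d with j <= m rows and m columns that are
    built one row at a time, then shows that the sum of |G_(rank d)| over all d is
    exactly |GL_m| (1 + 1) (1 + q) ... (1 + q^(j-1)) ([sum_norm_gauss_sum]).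

    The admissible X are the matrices whose rows lie in a certain kernel.  Their
    blocks c are the products of an arbitrary matrix by a fixed one of rank
    j <= min (r, m); the ranks of such products are distributed like those of the
    matrices d, except that everything is repeated q^(m (n - r)) times
    ([sum_norm_gauss_sum_kernel]).  Moreover X has at most q^(s m) |GL_s| completions
    to an element of GL_n.  Altogether, bounding j by J = min (r, m),
      |K| <= q^(s m + m (n - r)) |GL_s| (1 + 1) (1 + q) ... (1 + q^(J-1))
    ([norm_kloosterman_sum_le]).  The first factor 1 + 1 provides the constant 2 of
    the theorem.  The other ones are compensated by the factors q^i - 1 of |GL_s|
    because (q^i - 1) (q^i + 1) <= q^(2 i); when there are too few of the latter,
    that is when s < J - 1, the exponent in the theorem leaves enough room
    ([exponent_le]). *)

Set Implicit Arguments.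
Unset Strict Implicit.
Unset Printing Implicit Defensive.

Import Order.TTheory GRing.Theory Num.Theory.

Local Open Scope ring_scope.

(** * Sums over matrices *)

Definition gl_order (F : finFieldType) m : nat :=
  #|[pred g : 'M[F]_m | g \in unitmx]|.

Section MatrixReindexing.

Variables (C : comNzRingType) (F : finFieldType).

Lemma invmx_mulmx n (A B : 'M[F]_n) : A \in unitmx -> B \in unitmx ->
  invmx (A *m B) = invmx B *m invmx A.
Proof.
move=> uA uB; have uAB : A *m B \in unitmx by rewrite unitmx_mul uA.
apply: (can_inj (mulKmx uAB)); rewrite mulmxV // -mulmxA (mulmxA B) mulmxV //.
by rewrite mul1mx mulmxV.
Qed.

Lemma sum_col_mx m1 m2 n (f : 'M[F]_(m1 + m2, n) -> C) :
  \sum_x f x = \sum_(v : 'M_(m1, n)) \sum_(d : 'M_(m2, n)) f (col_mx v d).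
Proof.
rewrite pair_bigA (reindex (fun vd : 'M_(m1, n) * 'M_(m2, n) => col_mx vd.1 vd.2)) //.
exists (fun x => (usubmx x, dsubmx x)) => [[v d] _ | x _] /=.
  by rewrite col_mxKu col_mxKd.
by rewrite vsubmxK.
Qed.

Lemma sum_unitmx_mul m (L U : 'M[F]_m) (f : 'M_m -> C) :
    L \in unitmx -> U \in unitmx ->
  \sum_(g in unitmx) f (L *m g *m U) = \sum_(g in unitmx) f g.
Proof.
move=> uL uU.
rewrite [RHS](reindex_onto (fun g => L *m g *m U)
  (fun g => invmx L *m g *m invmx U)) /=; last first.
  by move=> g _; rewrite !mulmxA mulmxV // mul1mx mulmxKV.
apply: eq_bigl => g; rewrite !unitmx_mul uL uU andbT /=.
by rewrite !mulmxA mulVmx // mul1mx mulmxK // eqxx andbT.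
Qed.

Lemma sum_unitmx_inv m (f : 'M[F]_m -> C) :
  \sum_(g in unitmx) f (invmx g) = \sum_(g in unitmx) f g.
Proof.
rewrite [RHS](reindex_onto (@invmx F m) (@invmx F m)) /=; last first.
  by move=> g _; rewrite invmxK.
by apply: eq_bigl => g; rewrite unitmx_inv invmxK eqxx andbT.
Qed.

(** As [z] varies, [z *m col_base b] takes every value equally often and has the
    rank of [z *m b].  No fibre has to be counted: translating [z] by [d *m b'],
    where [b'] is a left inverse of [col_base b], adds [d] to that value, and one
    sums over all [d]. *)
Lemma sum_rank_mulmx m n p (b : 'M[F]_(n, p)) (f : nat -> C) :
  (#|F| ^ (m * \rank b))%:R * \sum_(z : 'M[F]_(m, n)) f (\rank (z *m b)) =
  (#|F| ^ (m * n))%:R * \sum_(d : 'M[F]_(m, \rank b)) f (\rank d).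
Proof.
set j := \rank b.
have rankE z : \rank (z *m b) = \rank (z *m col_base b) :> nat.
  by rewrite -[in LHS](mulmx_base b) mulmxA mxrankMfree ?row_base_free.
have /row_fullP[b' b'b] : row_full (col_base b) := col_base_full b.
have sum_cst (T : finType) (x : C) : #|T|%:R * x = \sum_(t : T) x.
  by rewrite sumr_const mulr_natl.
rewrite -!card_mx !sum_cst.
transitivity (\sum_(d : 'M[F]_(m, j)) \sum_(z : 'M[F]_(m, n))
    f (\rank (z *m col_base b + d)%R)).
  apply: eq_bigr => d _.
  rewrite (reindex (fun z => z + d *m b')) /=; last first.
    by exists (fun z => z - d *m b') => z _; rewrite ?addrK ?subrK.
  by apply: eq_bigr => z _; rewrite rankE mulmxDl -mulmxA b'b mulmx1.
rewrite exchange_big; apply: eq_bigr => z _ /=.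
rewrite [RHS](reindex (fun d => z *m col_base b + d)) //.
exists (fun d => d - z *m col_base b) => d _; first by rewrite addrC addKr.
by rewrite addrC subrK.
Qed.

Lemma rank_adds_row k m (d : 'M[F]_(k, m)) (v : 'rV_m) :
  \rank (d + v)%MS = (\rank d + ~~ (v <= d)%MS)%N.
Proof.
have [v_d | nv_d] /= := boolP (v <= d)%MS; first by rewrite addn0 (addsmx_idPl v_d).
have v_n0 : v != 0 by apply: contraNneq nv_d => ->; rewrite sub0mx.
rewrite mxrank_disjoint_sum ?rank_rV ?v_n0 //.
apply/eqP; rewrite -mxrank_eq0; case: eqP => // /eqP; rewrite -lt0n => rk_cap.
case/negP: nv_d; apply: submx_trans (capmxSl d v).
by rewrite -(geq_leqif (mxrank_leqif_sup (capmxSr d v))) rank_rV v_n0.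
Qed.

(** A row either lies in the row space of [d], which has [#|F| ^ \rank d]
    elements, or raises the rank by one. *)
Lemma sum_adds_row k m (d : 'M[F]_(k, m)) (f : nat -> C) :
  \sum_(v : 'rV_m) f (\rank (d + v)%MS) =
    #|F|%:R ^+ \rank d * f (\rank d) +
    (#|F|%:R ^+ m - #|F|%:R ^+ \rank d) * f (\rank d).+1.
Proof.
rewrite (bigID (fun v : 'rV_m => v <= d)%MS) /=.
rewrite (eq_bigr (fun=> f (\rank d))) => [|v v_d]; last first.
  by rewrite rank_adds_row v_d addn0.
rewrite [X in _ + X](eq_bigr (fun=> f (\rank d).+1)) => [|v v_d]; last first.
  by rewrite rank_adds_row v_d addn1.
have card_in : #|[pred v : 'rV_m | v <= d]%MS| = (#|F| ^ \rank d)%N.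
  by rewrite -card_rowg; apply: eq_card => v; rewrite !inE.
have card_out : #|[pred v : 'rV_m | ~~ (v <= d)%MS]| = (#|F| ^ m - #|F| ^ \rank d)%N.
  have := cardC [pred v : 'rV_m | v <= d]%MS.
  by rewrite card_in card_mx mul1n => <-; rewrite addKn.
rewrite !sumr_const card_in card_out -[f _ *+ (_ ^ _)]mulr_natl -[f _.+1 *+ _]mulr_natl.
rewrite natrB ?natrX //.
by rewrite leq_pexp2l ?rank_leq_col // ltnW // finNzRing_gt1.
Qed.

End MatrixReindexing.

(** * Gauss sums over the general linear group *)

Section AdditiveCharacter.

Variables (C : numFieldType) (F : finFieldType) (phi : F -> C).
Hypothesis phiD : {morph phi : x y / x + y >-> x * y}.
Hypothesis norm_phi : forall x, `|phi x| = 1.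
Hypothesis phi_nontrivial : exists x, phi x != 1.

Local Notation q := (#|F|%:R : C).

Lemma phi0 : phi 0 = 1.
Proof.
have phi0_n0 : phi 0 != 0 by rewrite -normr_eq0 norm_phi oner_eq0.
by apply: (mulfI phi0_n0); rewrite -phiD addr0 mulr1.
Qed.

(** Orthogonality: the trace form is nondegenerate, so [A != 0] makes the summand
    a nontrivial character of the group of matrices. *)
Lemma sum_phi_mxtrace m n (A : 'M[F]_(m, n)) :
  \sum_(w : 'M_(n, m)) phi (\tr (A *m w)) = q ^+ (n * m) *+ (A == 0).
Proof.
have [-> | A_n0] /= := eqVneq A 0.
  under eq_bigr do rewrite mul0mx mxtrace0 phi0.
  by rewrite sumr_const card_mx natrX mulr1n.
rewrite mulr0n; have [x phi_x] := phi_nontrivial.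
have [w0 tr_w0] : exists w0 : 'M_(n, m), \tr (A *m w0) = x.
  have [i [j Aij]] : exists i, exists j, A i j != 0.
    case: (pickP (fun ij => A ij.1 ij.2 != 0)) => [[i j] Aij | A0].
      by exists i, j.
    case/eqP: A_n0; apply/matrixP => i j.
    by rewrite mxE; apply/eqP; rewrite -[_ == _]negbK (A0 (i, j)).
  exists ((x / A i j) *: delta_mx j i).
  rewrite -scalemxAr mxtraceZ mxtrace_mulC /mxtrace (bigD1 j) //=.
  rewrite big1 => [|k /negPf j'k]; last first.
    by rewrite mxE big1 // => l _; rewrite mxE j'k mul0r.
  rewrite mxE (bigD1 i) //= big1 => [|k /negPf i'k]; last first.
    by rewrite mxE i'k andbF mul0r.
  by rewrite mxE !eqxx mul1r !addr0 divfK.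
have shift : phi x * \sum_(w : 'M_(n, m)) phi (\tr (A *m w)) =
    \sum_(w : 'M_(n, m)) phi (\tr (A *m w)).
  rewrite mulr_sumr [RHS](reindex (fun w => w0 + w)) /=; last first.
    by exists (fun w => - w0 + w) => w _; rewrite ?addKr ?addNKr.
  by apply: eq_bigr => w _; rewrite mulmxDr mxtraceD tr_w0 phiD.
apply/eqP; move/eqP: shift; rewrite -subr_eq0 -[X in _ - X]mul1r -mulrBl mulf_eq0.
by rewrite subr_eq0 (negPf phi_x).
Qed.

Definition gauss_sum m (c : 'M[F]_m) : C :=
  \sum_(g in unitmx) phi (\tr (c *m g)).

Lemma gauss_sum0 m : gauss_sum (0 : 'M_m) = (gl_order F m)%:R.
Proof.
rewrite /gauss_sum; under eq_bigr do rewrite mul0mx mxtrace0 phi0.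
by rewrite sumr_const.
Qed.

Lemma gauss_sum_rank m (c : 'M_m) : gauss_sum c = gauss_sum (pid_mx (\rank c) : 'M_m).
Proof.
rewrite /gauss_sum -[in RHS](sum_unitmx_mul _ (row_ebase_unit c) (col_ebase_unit c)).
apply: eq_bigr => g _; rewrite -[in LHS](mulmx_ebase c) -!mulmxA mxtrace_mulC.
by rewrite !mulmxA.
Qed.

(** Let [e] be the unit column vector of index [t], so that [c + e *m v] is
    [c := pid_mx t] with its zero row of index [t] replaced by [v].  For an
    invertible [g] the vector [g *m e] is nonzero, hence orthogonality cancels the
    sum over [v] of the values of the character at [\tr ((c + e *m v) *m g)].  On
    the other hand [c + e *m v] has the row space of [c] and [v] together, which
    gives the number of [v] for each rank. *)
Lemma gauss_sum_succ m t : (t < m)%N ->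
  q ^+ t * gauss_sum (pid_mx t : 'M_m) +
  (q ^+ m - q ^+ t) * gauss_sum (pid_mx t.+1 : 'M_m) = 0.
Proof.
move=> lt_tm; set c : 'M[F]_m := pid_mx t.
pose e : 'cV[F]_m := delta_mx (Ordinal lt_tm) 0.
have ete : e^T *m e = 1%:M.
  by rewrite trmx_delta mul_delta_mx; apply/matrixP => i j; rewrite !ord1 !mxE.
have etc : e^T *m c = 0.
  rewrite trmx_delta; apply/rowP => j; rewrite !mxE big1 // => k _; rewrite !mxE /=.
  by case: eqP => [->|]; rewrite ?ltnn ?andbF ?mulr0 ?mul0r.
have rk_c : \rank c = t by rewrite rank_pid_mx // ltnW.
have rank_cev v : \rank (c + e *m v)%R = \rank (c + v)%MS.
  apply: eqmx_rank; apply/andP; split.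
    by rewrite addmx_sub ?addsmxSl // (submx_trans (submxMl e v)) ?addsmxSr.
  have v_sub : (v <= (c + e *m v)%R)%MS.
    apply/submxP; exists e^T.
    by rewrite mulmxDr etc add0r mulmxA ete mul1mx.
  rewrite addsmx_sub v_sub andbT -[X in (X <= _)%MS](addrK (e *m v) c).
  by rewrite addmx_sub // eqmx_opp (submx_trans (submxMl e v)).
have := sum_adds_row c (fun r => gauss_sum (pid_mx r : 'M_m)).
rewrite rk_c => <-.
under eq_bigr do rewrite -rank_cev -gauss_sum_rank.
rewrite exchange_big big1 // => g g_unit.
under eq_bigr => v _.
  rewrite mulmxDl mxtraceD phiD -mulmxA [X in _ * phi X]mxtrace_mulC -mulmxA.
  rewrite [X in _ * phi X]mxtrace_mulC.
  over.
rewrite -mulr_sumr sum_phi_mxtrace; case: eqP => [ge0 | _]; last by rewrite mulr0.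
have e0 : e = 0 by rewrite -[e](mulKmx g_unit) ge0 mulmx0.
by move: ete; rewrite e0 mulmx0 => /matrixP/(_ 0 0)/eqP; rewrite !mxE eq_sym oner_eq0.
Qed.

Lemma norm_gauss_sum_succ m t : (t < m)%N ->
  (q ^+ m - q ^+ t) * `|gauss_sum (pid_mx t.+1 : 'M_m)| =
  q ^+ t * `|gauss_sum (pid_mx t : 'M_m)|.
Proof.
move=> lt_tm; have /eqP := gauss_sum_succ lt_tm.
rewrite addr_eq0 => /eqP/(congr1 (@Num.norm _ _)).
have q_ge1 : 1 <= q by rewrite ler1n ltnW // finNzRing_gt1.
rewrite normrN !normrM ger0_norm ?exprn_ge0 ?ler0n // => ->.
by rewrite ger0_norm // subr_ge0 ler_weXn2l // ltnW.
Qed.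

(** The weight [q ^+ (i * \rank d)] makes the induction on [j] work: summing over
    one row of the matrix multiplies the weighted sum by [1 + q ^+ i] and, by
    [norm_gauss_sum_succ], turns the weight [i] into [i.+1]. *)
Lemma sum_norm_gauss_sum m j i : (j <= m)%N ->
  \sum_(d : 'M[F]_(j, m)) q ^+ (i * \rank d) * `|gauss_sum (pid_mx (\rank d) : 'M_m)| =
  (gl_order F m)%:R * \prod_(l < j) (1 + q ^+ (i + l)).
Proof.
elim: j i => [|j IHj] i lt_jm.
  rewrite (big_pred1 0) => [|d]; last by rewrite /= [d]flatmx0 eqxx.
  by rewrite mxrank0 muln0 mul1r big_ord0 mulr1 pid_mx_0 gauss_sum0 normr_nat.
pose f r : C := q ^+ (i * r) * `|gauss_sum (pid_mx r : 'M_m)|.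
rewrite (sum_col_mx (m1 := 1) (fun d => f (\rank d))) exchange_big /=.
have step (d : 'M[F]_(j, m)) : \sum_(v : 'rV_m) f (\rank (col_mx v d)) =
    (1 + q ^+ i) * (q ^+ (i.+1 * \rank d) * `|gauss_sum (pid_mx (\rank d) : 'M_m)|).
  transitivity (\sum_(v : 'rV_m) f (\rank (d + v)%MS)).
    by apply: eq_bigr => v _; rewrite addsmxC addsmxE.
  have lt_dm : (\rank d < m)%N by rewrite (leq_ltn_trans (rank_leq_row d)).
  rewrite sum_adds_row /f [X in _ + X]mulrCA norm_gauss_sum_succ // mulnS mulSn !exprD.
  by ring.
rewrite (eq_bigr _ (fun d _ => step d)) -mulr_sumr IHj 1?ltnW //.
rewrite big_ord_recl addn0 mulrCA; congr (_ * (_ * _)).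
by apply: eq_bigr => l _; rewrite addnS addSn.
Qed.

(** * Matrix Kloosterman sums of an additive character *)

Definition kloosterman_sum n (a b : 'M[F]_n) : C :=
  \sum_(x in unitmx) phi (\tr (a *m x + b *m invmx x)).

(** Averaging over the stabilizer [u w g] of [pid_mx s].  Blockwise,
    [\tr (u w g *m (x *m b))] separates into a part that depends only on [x], a
    part linear in [w], whose sum is an orthogonality relation, and a part linear
    in [g], whose sum is a Gauss sum. *)
Lemma norm_kloosterman_sum_pid s m (b : 'M_(s + m)) :
  (gl_order F m)%:R * `|kloosterman_sum b (pid_mx s)| <=
  \sum_(x in unitmx | dsubmx x *m lsubmx b == 0)
    `|gauss_sum (dsubmx x *m rsubmx b)|.
Proof.
set P : 'M_(s + m) := pid_mx s; set S := kloosterman_sum b P.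
have q_gt0 : 0 < q by rewrite ltr0n ltnW // finNzRing_gt1.
pose u (w : 'M[F]_(s, m)) (g : 'M[F]_m) : 'M[F]_(s + m) := block_mx 1%:M w 0 g.
have u_unit w g : g \in unitmx -> u w g \in unitmx.
  by rewrite !unitmxE det_ublock det1 mul1r.
have uP w g : u w g *m P = P.
  rewrite /P pid_mx_block mulmx_block !(mulmx0, mul0mx, mulmx1, mul1mx).
  by rewrite !addr0.
have S_shift w g : g \in unitmx -> S = \sum_(x in unitmx)
    phi (\tr (P *m invmx x)) * phi (\tr (ulsubmx (x *m b))) *
    (phi (\tr (dlsubmx (x *m b) *m w)) * phi (\tr (drsubmx (x *m b) *m g))).
  move=> g_unit; rewrite /S /kloosterman_sum.
  rewrite -(sum_unitmx_mul _ (u_unit w g g_unit) (unitmx1 _ _)).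
  apply: eq_bigr => x x_unit; rewrite mulmx1 mxtraceD phiD mulrC -!mulrA.
  congr (_ * _).
    congr (phi _); rewrite invmx_mulmx ?u_unit // mulmxA mxtrace_mulC mulmxA.
    by rewrite -[in LHS](uP w g) mulKmx ?u_unit.
  rewrite -!phiD; congr (phi _).
  rewrite mxtrace_mulC -mulmxA -[x *m b in LHS]submxK mulmx_block mxtrace_block.
  rewrite mul1mx mul0mx add0r mxtraceD addrA.
  by rewrite (mxtrace_mulC w) (mxtrace_mulC g).
rewrite -(ler_pM2l (exprn_gt0 (s * m) q_gt0)).
(* The sum of the constant [S] over all [w] and [g] is computed in two ways: by
   counting the terms, and from [S_shift] by exchanging the sums. *)
have -> : q ^+ (s * m) * ((gl_order F m)%:R * `|S|) =
    `|\sum_(w : 'M[F]_(s, m)) \sum_(g : 'M[F]_m | g \in unitmx) S|.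
  rewrite !sumr_const card_mx -mulrnA normrMn -[RHS]mulr_natl natrM natrX.
  by rewrite mulrA [(_ ^+ _) * _]mulrC.
have -> : \sum_(w : 'M[F]_(s, m)) \sum_(g : 'M[F]_m | g \in unitmx) S =
    \sum_(x in unitmx) phi (\tr (P *m invmx x)) * phi (\tr (ulsubmx (x *m b))) *
    (q ^+ (s * m) *+ (dlsubmx (x *m b) == 0) * gauss_sum (drsubmx (x *m b))).
  rewrite (eq_bigr _ (fun w _ => eq_bigr _ (S_shift w))).
  under eq_bigr do rewrite exchange_big /=.
  rewrite exchange_big /=; apply: eq_bigr => x x_unit.
  under eq_bigr do rewrite -mulr_sumr -mulr_sumr.
  by rewrite -mulr_sumr -mulr_suml sum_phi_mxtrace.
rewrite (le_trans (ler_norm_sum _ _ _)) // mulr_sumr [leRHS]big_mkcondr /=.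
apply: ler_sum => x _; rewrite !normrM !norm_phi !mul1r.
rewrite normrMn (ger0_norm (exprn_ge0 _ (ltW q_gt0))).
rewrite mulmx_lsub mulmx_rsub mul_dsub_mx -/(dlsubmx _) -/(drsubmx _).
by case: eqP; rewrite ?mulr1n ?mulr0n ?mul0r.
Qed.

(** If [h] is one completion of [X], then any other one is [h] multiplied on the
    left by a block matrix with last rows [0, 1], which is determined by an
    invertible block of size [s] and an arbitrary block. *)
Lemma card_unitmx_dsubmx s m (X : 'M[F]_(m, s + m)) :
  (#|[pred x : 'M_(s + m) | (x \in unitmx) && (dsubmx x == X)]| <=
    #|F| ^ (s * m) * gl_order F s)%N.
Proof.
set A := [pred x | _].
have [h /andP[h_unit /eqP hX] | A0] := pickP A; last by rewrite eq_card0.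
rewrite -(@card_mx F s m) -cardX.
pose ext (wp : 'M[F]_(s, m) * 'M[F]_s) := block_mx wp.2 wp.1 0 1%:M *m h.
apply: leq_trans (leq_imset_card ext _); apply: subset_leq_card.
apply/subsetP => x /andP[x_unit /eqP xX].
pose y := x *m invmx h.
have x_yh : x = y *m h by rewrite mulmxKV.
have dy : dsubmx y = row_mx 0 1%:M.
  rewrite -mul_dsub_mx xX -hX mul_dsub_mx mulmxV //.
  by rewrite scalar_mx_block /block_mx col_mxKd.
have y_block : y = block_mx (ulsubmx y) (ursubmx y) 0 1%:M.
  by rewrite -[LHS]vsubmxK dy -[usubmx y]hsubmxK.
apply/imsetP; exists (ursubmx y, ulsubmx y); last by rewrite /ext /= -y_block.
rewrite !inE /=.
have : y \in unitmx by rewrite unitmx_mul x_unit unitmx_inv.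
by rewrite {1}y_block !unitmxE det_ublock det1 mulr1.
Qed.

Lemma sum_kermx n p m (A : 'M[F]_(n, p)) (h : 'M[F]_(m, n) -> C) :
  \sum_(X | X *m A == 0) h X = \sum_z h (z *m row_base (kermx A)).
Proof.
rewrite (reindex_onto (fun z => z *m row_base (kermx A))
  (fun X => X *m pinvmx (row_base (kermx A)))) /=; last first.
  by move=> X /eqP/sub_kermxP XA; rewrite mulmxKpV // eq_row_base.
apply: eq_bigl => z; rewrite mulmxKp ?row_base_free // eqxx andbT.
by apply/eqP/sub_kermxP; rewrite (submx_trans (submxMl _ _)) ?eq_row_base.
Qed.

(** Let [N] be a basis of the kernel of [lsubmx b], so that the rows of [X] are
    arbitrary combinations of those of [N].  Since the kernel of [b] is contained
    in that of [lsubmx b], the matrix [N *m rsubmx b], which has the rank [j] of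
    [N *m b], has [j + (s + m - \rank b)] rows.  By [sum_rank_mulmx],
    the sum is therefore that of [sum_norm_gauss_sum], up to transposition and a
    power of [#|F|]. *)
Lemma sum_norm_gauss_sum_kernel s m (b : 'M[F]_(s + m)) :
  \sum_(X : 'M[F]_(m, s + m) | X *m lsubmx b == 0)
    `|gauss_sum (X *m rsubmx b)| <=
  q ^+ (m * (s + m - \rank b)) * (gl_order F m)%:R *
  \prod_(l < minn (\rank b) m) (1 + q ^+ l).
Proof.
have q_gt0 : 0 < q by rewrite ltr0n ltnW // finNzRing_gt1.
rewrite sum_kermx; set N := row_base _.
set B := N *m rsubmx b; set j := \rank B.
have Nl0 : N *m lsubmx b = 0 by apply/sub_kermxP; rewrite eq_row_base.
have rank_Nb : \rank (N *m b) = j.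
  have <- : row_mx (N *m lsubmx b) B = N *m b by rewrite -mul_mx_row hsubmxK.
  by rewrite Nl0 rank_row_0mx.
have ker_b_N : (kermx b <= N)%MS.
  rewrite eq_row_base; apply/sub_kermxP.
  by rewrite mulmx_lsub mulmx_ker linear0.
have dim_N : \rank (kermx (lsubmx b)) = (j + (s + m - \rank b))%N.
  have := mxrank_mul_ker N b.
  by rewrite rank_Nb (capmx_idPr ker_b_N) mxrank_ker eq_row_base => <-.
have le_jm : (j <= m)%N := rank_leq_col _.
have le_jr : (j <= \rank b)%N by rewrite -rank_Nb mxrankM_maxr.
pose f t : C := `|gauss_sum (pid_mx t : 'M_m)|.
have eq_f z : `|gauss_sum (z *m N *m rsubmx b)| = f (\rank (z *m B)).
  by rewrite -mulmxA gauss_sum_rank.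
under eq_bigr do rewrite eq_f.
have pow_N : (#|F| ^ (m * \rank (kermx (lsubmx b))))%:R =
    q ^+ (m * j) * q ^+ (m * (s + m - \rank b)).
  by rewrite dim_N mulnDr expnD natrM !natrX.
have := sum_rank_mulmx m B f; rewrite -/j pow_N natrX => sum_B.
rewrite -mulrA in sum_B.
rewrite (mulfI (expf_neq0 _ (lt0r_neq0 q_gt0)) sum_B) -mulrA ler_pM2l ?exprn_gt0 //.
have -> : \sum_(d : 'M[F]_(m, j)) f (\rank d) =
    (gl_order F m)%:R * \prod_(l < j) (1 + q ^+ l).
  have := sum_norm_gauss_sum 0 le_jm.
  under [X in _ = _ * X]eq_bigr do rewrite add0n.
  move=> <-; rewrite (reindex trmx) /=; last first.
    by exists trmx => d _; rewrite trmxK.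
  by apply: eq_bigr => d _; rewrite mxrank_tr mul0n expr0 mul1r.
rewrite ler_wpM2l ?ler0n //.
have le_j : (j <= minn (\rank b) m)%N by rewrite leq_min le_jr le_jm.
rewrite -(subnKC le_j) -!(big_mkord xpredT (fun l => 1 + q ^+ l)).
rewrite [leRHS](big_cat_nat (n := j)) //= ?leq_addr // ler_peMr ?prodr_ge0 //.
  by move=> l _; rewrite addr_ge0 ?exprn_ge0 ?ltW.
by elim/big_ind: _ => // [x y|l _]; [exact: mulr_ege1 | rewrite lerDl exprn_ge0 ?ltW].
Qed.

Lemma kloosterman_sum_pid n (a b : 'M[F]_n) :
  exists2 b', \rank b' = \rank b &
    kloosterman_sum a b = kloosterman_sum b' (pid_mx (\rank a) : 'M_n).
Proof.
exists (row_ebase a *m b *m col_ebase a).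
  rewrite mxrankMfree ?row_free_unit ?col_ebase_unit //.
  by rewrite eqmxMfull // row_full_unit row_ebase_unit.
rewrite /kloosterman_sum -sum_unitmx_inv.
rewrite -(sum_unitmx_mul _ (col_ebase_unit a) (row_ebase_unit a)).
apply: eq_bigr => x x_unit; congr (phi _).
have [L_unit U_unit] := (col_ebase_unit a, row_ebase_unit a).
rewrite invmxK !invmx_mulmx ?unitmx_mul ?L_unit //.
rewrite -{1}(mulmx_ebase a) addrC !mxtraceD; congr (_ + _).
  by rewrite mulmxA mxtrace_mulC !mulmxA.
by rewrite !mulmxA mulmxK // mxtrace_mulC -!mulmxA mulKmx.
Qed.

(** Grouping the invertible [x] by their last [m] rows reduces the sum in
    [norm_kloosterman_sum_pid] to the one in [sum_norm_gauss_sum_kernel], at the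
    cost of the multiplicities bounded in [card_unitmx_dsubmx]. *)
Lemma norm_kloosterman_sum_le s m (a b : 'M[F]_(s + m)) :
    \rank a = s ->
  `|kloosterman_sum a b| <=
    (#|F| ^ (s * m + m * (s + m - \rank b)) * gl_order F s)%:R *
    \prod_(l < minn (\rank b) m) (1 + q ^+ l).
Proof.
move=> rk_a; have [b' rk_b' ->] := kloosterman_sum_pid a b; rewrite rk_a -rk_b'.
have glm_gt0 : 0 < (gl_order F m)%:R :> C.
  by rewrite ltr0n; apply/card_gt0P; exists 1%:M; rewrite inE unitmx1.
rewrite -(ler_pM2l glm_gt0) (le_trans (norm_kloosterman_sum_pid b')) //.
rewrite (partition_big dsubmx (fun X => X *m lsubmx b' == 0)) /=; last first.
  by move=> x /andP[].
apply: (@le_trans _ _ (\sum_(X : 'M[F]_(m, s + m) | X *m lsubmx b' == 0)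
    (#|F| ^ (s * m) * gl_order F s)%:R * `|gauss_sum (X *m rsubmx b')|)).
  apply: ler_sum => X X0.
  rewrite (eq_bigr (fun=> `|gauss_sum (X *m rsubmx b')|)); last first.
    by move=> x /andP[_ /eqP->].
  rewrite sumr_const -[leLHS]mulr_natl ler_wpM2r ?normr_ge0 // ler_nat.
  apply: leq_trans (card_unitmx_dsubmx X); apply: subset_leq_card.
  by apply/subsetP => x; rewrite !inE => /andP[/andP[-> _] ->].
rewrite -mulr_sumr expnD mulnAC (natrM _ (_ * _)) -[X in _ <= _ * X]mulrA.
rewrite [leRHS]mulrCA ler_wpM2l ?ler0n //.
by rewrite (le_trans (sum_norm_gauss_sum_kernel b')) // natrX mulrCA mulrA.
Qed.

End AdditiveCharacter.

(** * Numerical estimates *)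

Section CountingEstimates.

Local Open Scope nat_scope.

Lemma gl_orderE (F : finFieldType) m :
  gl_order F m = #|F| ^ 'C(m, 2) * \prod_(1 <= i < m.+1) (#|F| ^ i - 1).
Proof.
case: m => [|m]; last by rewrite -card_GL // cardsT card_sub.
rewrite big_geq // muln1 /gl_order (eq_card1 (x := 0%R)) // => g.
by rewrite !inE [g]flatmx0 eqxx unitmxE det_mx00 unitr1.
Qed.

Lemma gl_order_le (F : finFieldType) m : gl_order F m <= #|F| ^ (m ^ 2).
Proof. by rewrite -mulnn -card_mx max_card. Qed.

(** The factors with the same [i] are paired through
    [(q ^ i - 1) * (1 + q ^ i) <= q ^ (i + i)].  An unpaired [q ^ i - 1] is at most
    [q ^ i], and an unpaired [1 + q ^ i] at most [q ^ i.+1]: this costs one more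
    power of [q] for each of the [l - k] of them. *)
Lemma prod_pred_succ_pow_le q k l : 1 < q ->
  \prod_(1 <= i < k.+1) (q ^ i - 1) * \prod_(1 <= i < l.+1) (1 + q ^ i) <=
  q ^ ('C(k.+1, 2) + 'C(l.+1, 2) + (l - k)).
Proof.
move=> q_gt1; have q_gt0 := ltnW q_gt1.
have prodS (f : nat -> nat) n :
    \prod_(1 <= i < n.+2) f i = \prod_(1 <= i < n.+1) f i * f n.+1.
  by rewrite big_nat_recr.
have diag n : \prod_(1 <= i < n.+1) (q ^ i - 1) * \prod_(1 <= i < n.+1) (1 + q ^ i) <=
    q ^ ('C(n.+1, 2) + 'C(n.+1, 2)).
  elim: n => [|n IHn]; first by rewrite !big_geq.
  rewrite !prodS mulnACA ['C(n.+2, 2)]binS bin1 addnACA expnD leq_mul //.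
  by rewrite -[_ + q ^ _]addnC -subn_sqr -expnM muln2 addnn leq_subr.
have [le_kl | /ltnW le_lk] := leqP k l.
  rewrite -{1 2}(subnKC le_kl); elim: (l - k) => [|d IHd]; first by rewrite !addn0.
  rewrite addnS prodS mulnA ['C(_.+2, 2)]binS bin1.
  have -> : 'C(k.+1, 2) + ('C((k + d).+1, 2) + (k + d).+1) + d.+1 =
      'C(k.+1, 2) + 'C((k + d).+1, 2) + d + (k + d).+2 by lia.
  rewrite expnD leq_mul // [q ^ (k + d).+2]expnS.
  apply: (@leq_trans (2 * q ^ (k + d).+1)); last by rewrite leq_mul2r q_gt1 orbT.
  by rewrite mul2n -addnn leq_add2r expn_gt0 q_gt0.
rewrite (eqP le_lk) addn0 -{1 2}(subnKC le_lk).
elim: (k - l) => [|d IHd]; first by rewrite !addn0.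
rewrite addnS prodS mulnAC ['C(_.+2, 2)]binS bin1 addnAC expnD leq_mul //.
by rewrite leq_subr.
Qed.

(** The constant 2 is the factor [l = 0] of the product. *)
Lemma gl_order_mul_prod_le (F : finFieldType) s J :
  gl_order F s * \prod_(l < J) (1 + #|F| ^ l) <=
  2 * #|F| ^ (s ^ 2 + 'C(J, 2) + (J.-1 - s)).
Proof.
have q_gt1 : 1 < #|F| := finNzRing_gt1 _.
case: J => [|J] /=.
  by rewrite big_ord0 muln1 !addn0 (leq_trans (gl_order_le F s)) // leq_pmull.
rewrite -(big_mkord xpredT (fun l => 1 + #|F| ^ l)) big_nat_recl //.
rewrite expn0 mulnCA leq_mul2l /=.
rewrite -(big_add1 _ _ 0 J.+1 xpredT (fun l => 1 + #|F| ^ l)) gl_orderE -mulnA.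
have -> : s ^ 2 + 'C(J.+1, 2) + (J - s) =
    'C(s, 2) + ('C(s.+1, 2) + 'C(J.+1, 2) + (J - s)).
  have -> : s ^ 2 = 'C(s, 2) + 'C(s.+1, 2).
    have := mul_bin_left s 1; rewrite binS bin1 -mulnn; nia.
  by rewrite !addnA.
by rewrite expnD leq_mul2l prod_pred_succ_pow_le ?orbT.
Qed.

(** When [e] increases by one, the binomial coefficient increases only while
    [minn r e < r], and then by [minn r e], hence by at most [r.-1]. *)
Lemma bin2_minn_le r e d :
  'C(minn r (e + d), 2) <= 'C(minn r e, 2) + d * r.-1.
Proof.
elim: d => [|d IHd]; first by rewrite addn0 leq_addr.
rewrite addnS mulSn; have [le_r | lt_r] := leqP r (e + d).
  have -> : minn r (e + d).+1 = minn r (e + d) by lia.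
  lia.
have -> : minn r (e + d).+1 = (minn r (e + d)).+1 by lia.
rewrite binS bin1; lia.
Qed.

(** In terms of [d := r - s] and [e := s + m - r], where [m = d + e], the claim is
    that ['C(minn r (d + e), 2) + ((minn r (d + e)).-1 - s)] is at most
    ['C(minn r e, 2) + d * r].  By [bin2_minn_le], passing from [e] to [d + e] in
    the binomial coefficient uses [d * r.-1] of the room [d * r]; the remaining [d]
    covers the last term, since [minn r m <= s + d]. *)
Lemma exponent_le s m r : s <= r <= s + m ->
  s * m + m * (s + m - r) + (s ^ 2 + 'C(minn r m, 2) + ((minn r m).-1 - s)) <=
  (s + m) ^ 2 - r * (s + m) + r ^ 2 + 'C(minn r (s + m - r), 2).
Proof.
move=> /andP[/subnKC <-]; set d := r - s => le_dm.
have [e ->] : exists e, m = d + e by exists (m - d); lia.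
have -> : s + (d + e) - (s + d) = e by lia.
have -> : (s + (d + e)) ^ 2 - (s + d) * (s + (d + e)) = e * (s + d + e) by nia.
have := bin2_minn_le (s + d) e d; rewrite [e + d]addnC.
have : (minn (s + d) (d + e)).-1 - s <= d by lia.
case: (posnP (s + d)) => [|r_gt0]; first by nia.
have : d * (s + d).-1 + d = d * (s + d) by rewrite -mulnSr prednK.
rewrite -!mulnn; nia.
Qed.

End CountingEstimates.

(** * The canonical additive character of a finite field *)

Section FieldCharacter.

Variables (R : realType) (F : finFieldType) (p : nat) (pcharF : p \in [pchar F]).

Let Fp_ext := pPrimeCharType pcharF.

Lemma Fp_traceD : {morph Fp_trace pcharF : x y / x + y}.
Proof.
move=> x y; apply: (fmorph_inj (in_alg Fp_ext)).
by rewrite rmorphD /= !Fp_traceE raddfD.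
Qed.

(** By Dedekind's independence of characters, the sum of the elements of the
    Galois group is not the zero function. *)
Lemma Fp_trace_neq0 : exists x, Fp_trace pcharF x != 0.
Proof.
have id_gal : 1%g \in 'Gal({:Fp_ext} / 1%AS)%g by exact: group1.
have [x _ tr_x] :=
  gal_independent_contra (c_ := fun=> 1) id_gal (oner_neq0 Fp_ext).
exists x; apply: contraNneq tr_x => tr0; apply/eqP.
under eq_bigr do rewrite mul1r.
by have := Fp_traceE pcharF x; rewrite tr0 scale0r => /esym.
Qed.

Lemma expiD (s t : R) : expi (s + t) = expi s * expi t.
Proof. by rewrite /expi cosD sinD; congr Complex; rewrite addrC. Qed.

Lemma expiMn (t : R) k : expi (t *+ k) = expi t ^+ k.
Proof.
elim: k => [|k IHk]; last by rewrite mulrS expiD IHk exprS.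
by rewrite mulr0n /expi cos0 sin0.
Qed.

Lemma expi2pi : expi (2 * pi) = 1 :> R[i].
Proof. by rewrite /expi mulr_natl cos2pi sin2pi. Qed.

(** Halving the angle brings it into the interval between 0 and pi, where the
    sine is positive, and [cos t = 1 - 2 * sin (t / 2) ^+ 2]. *)
Lemma expi_neq1 (t : R) : 0 < t < 2 * pi -> expi t != 1.
Proof.
move=> /andP[t_gt0 t_lt]; apply/eqP => -[cos_t _].
have half : t = (t / 2) *+ 2 by rewrite -mulr_natr divfK // pnatr_eq0.
have sin_gt0 : 0 < sin (t / 2).
  by rewrite sin_gt0_pi // divr_gt0 //= ltr_pdivrMr // mulrC.
have sq := cos2Dsin2 (t / 2); rewrite half cos_mulr2n in cos_t.
have : sin (t / 2) ^+ 2 = 0 by lra.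
by move/eqP; rewrite expf_eq0 /= gt_eqF.
Qed.

Let zeta : R[i] := expi (2 * pi / p%:R).

Let p_gt0 : (0 < p)%N := prime_gt0 (pcharf_prime pcharF).

Let p_neq0 : p%:R != 0 :> R.
Proof. by rewrite pnatr_eq0 -lt0n. Qed.

(** As a power of a [p]-th root of unity, the character is visibly compatible
    with the reduction modulo [p] of the representatives of the traces. *)
Lemma add_charE x : add_char R pcharF x = zeta ^+ Fp_trace pcharF x.
Proof. by rewrite /add_char mulrAC mulr_natr expiMn. Qed.

Let zeta_p : zeta ^+ p = 1.
Proof. by rewrite /zeta -expiMn -[_ *+ p]mulr_natr divfK // expi2pi. Qed.

Lemma add_charD : {morph add_char R pcharF : x y / x + y >-> x * y}.
Proof.
have valD (k l : 'F_p) : (k + l)%R = ((k + l) %% p)%N :> nat.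
  by rewrite /=; congr (_ %% _)%N; exact: Fp_cast (pcharf_prime pcharF).
by move=> x y; rewrite !add_charE Fp_traceD -exprD valD expr_mod.
Qed.

Lemma norm_add_char x : `|add_char R pcharF x| = 1.
Proof.
rewrite add_charE normrX.
suff -> : `|zeta| = 1 by rewrite expr1n.
by apply/eqP; rewrite -(pexpr_eq1 p_gt0) ?normr_ge0 // -normrX zeta_p normr1.
Qed.

Lemma add_char_nontrivial : exists x, add_char R pcharF x != 1.
Proof.
have [x tr_x] := Fp_trace_neq0; exists x; rewrite /add_char.
set k : nat := Fp_trace pcharF x.
have k_gt0 : (0 < k)%N by rewrite lt0n.
have k_lt : (k < p)%N.
  by rewrite -[X in (_ < X)%N](Fp_cast (pcharf_prime pcharF)) ltn_ord.
have tau_gt0 : 0 < 2 * pi :> R by rewrite mulr_gt0 ?pi_gt0.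
rewrite expi_neq1 // divr_gt0 ?mulr_gt0 ?ltr0n ?pi_gt0 //=.
by rewrite ltr_pdivrMr ?ltr0n // ltr_pM2l // ltr_nat.
Qed.

End FieldCharacter.

Theorem theorem1p10 (R : realType) (F : finFieldType) (p : nat)
    (pcharF : p \in [pchar F]) (n : nat) (a b : 'M[F]_n) (r s : nat)
    (a_sing : a \notin unitmx) (b_sing : b \notin unitmx)
    (rk_b : \rank b = r) (rk_a : \rank a = s) (le_sr : (s <= r)%N) :
  `|kloosterman R pcharF a b|
    <= 2 * #|F|%:R ^+ (n ^ 2 - r * n + r ^ 2 + 'C(minn r (n - r), 2)).
Proof.
have [m n_sm] : exists m, n = (s + m)%N.
  by exists (n - s)%N; rewrite subnKC // -rk_a rank_leq_col.
subst n.
have le_r : (r <= s + m)%N by rewrite -rk_b rank_leq_col.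
have bound := norm_kloosterman_sum_le (@add_charD R F p pcharF)
  (@norm_add_char R F p pcharF) (@add_char_nontrivial R F p pcharF) b rk_a.
rewrite rk_b in bound; apply: le_trans bound _.
have -> : \prod_(l < minn r m) (1 + #|F|%:R ^+ l) =
    (\prod_(l < minn r m) (1 + #|F| ^ l))%N%:R :> R[i].
  by rewrite natr_prod; apply: eq_bigr => l _; rewrite natrD natrX.
rewrite -natrM -natrX -natrM ler_nat -mulnA.
have q_gt0 : (0 < #|F|)%N by rewrite ltnW // finNzRing_gt1.
apply: leq_trans (leq_mul (leqnn _) (gl_order_mul_prod_le F s _)) _.
rewrite mulnCA -expnD leq_mul2l leq_pexp2l ?orbT // exponent_le //.
by rewrite le_sr.
Qed.
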